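(* Let $(\Omega,\mathcal F,\mathbb P)$ be a nonatomic probability space and $1\le p\le\infty$. Let $\mathcal A^\alpha\subset L^p$ be the acceptance set based on Tail Value-at-Risk at level $\alpha\in(0,1)$, and let $S=(S_0,S_T)$ be a traded asset. Then $\rho_{\mathcal A^\alpha,S}$ is cash subadditive if and only if $\operatorname{TVaR}_\alpha(S_T)\le -S_0$. In particular, if $\rho_{\mathcal A^\alpha,S}$ is cash subadditive then $\mathbb P(S_T<S_0)\le\alpha$.
   Context: $L^p=L^p(\Omega,\mathcal F,\mathbb P)$ with the almost sure order and positive cone $L^p_+$. For $\beta\in(0,1)$, $\operatorname{VaR}_\beta(X)=\inf\{m\in\mathbb R : \mathbb P(X+m<0)\le\beta\}$, $\operatorname{TVaR}_\alpha(X)=\frac1\alpha\int_0^\alpha\operatorname{VaR}_\beta(X)\,d\beta$, and $\mathcal A^\alpha=\{X\in L^p : \operatorname{TVaR}_\alpha(X)\le0\}$. A traded asset is a pair $S=(S_0,S_T)$ with $S_0>0$ real and $S_T\in L^p_+$ nonzero. The risk measure is $\rho_{\mathcal A^\alpha,S}(X)=\inf\{m\in\mathbb R : X+\frac{m}{S_0}S_T\in\mathcal A^\alpha\}\in\mathbb R\cup\{\pm\infty\}$ with $\inf\emptyset=\infty$. A function $\rho:L^p\to\mathbb R\cup\{\pm\infty\}$ is cash subadditive if it is decreasing ($X\le Y$ implies $\rho(X)\ge\rho(Y)$) and $\rho(X+\lambda 1_\Omega)\ge\rho(X)-\lambda$ for all $\lambda>0$ and $X\in L^p$. *)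

(* Defs.v *)
From HB Require Import structures.
From mathcomp Require Import all_boot all_order all_algebra.
From mathcomp Require Import all_classical all_reals all_analysis.

Set Implicit Arguments.
Unset Strict Implicit.
Unset Printing Implicit Defensive.

Import Order.TTheory GRing.Theory Num.Theory.
Import numFieldNormedType.Exports.

Local Open Scope classical_set_scope.
Local Open Scope ring_scope.

(* Elements of L^p are represented by p-integrable measurable functions
   (LfunType), without passing to the quotient: the order is the almost sure
   order, so that equality in L^p is almost sure equality. *)

Definition nonatomic d (T : measurableType d) (R : realType)
    (P : {measure set T -> \bar R}) : Prop :=
  forall E : set T, measurable E -> (0 < P E)%E ->
  exists F : set T,
    [/\ measurable F, F `<=` E, (0 < P F)%E & (P F < P E)%E].

Section Lp.
Context d (T : measurableType d) (R : realType) (P : probability T R).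
Variables (p : \bar R) (p1 : (1 <= p)%E).

Definition le_as (X Y : T -> R) : Prop := {ae P, forall w, X w <= Y w}.

Lemma Lp_one_subproof : (\1_[set: T] : T -> R) \in Lfun P p.
Proof.
suff -> : \1_[set: T] = cst 1 :> (T -> R).
  apply: (@Lfun_subset _ _ _ P p +oo%E p1); rewrite ?leey//.
    exact: fin_num_measure.
  rewrite inE/=; apply/andP; split; rewrite inE//=.
  rewrite /finite_norm unlock /Lnorm/=; case: ifPn => [P0|//].
  have -> : abse \o (EFin \o cst 1) = cst 1%E :> (T -> \bar R).
    by apply/funext => w /=; rewrite normr1.
  by rewrite ess_sup_inf.ess_sup_cst// ltry.
by apply/funext => w; rewrite indicE in_setT.
Qed.

Definition Lp_one : LfunType P p1 := Lfun_Sub p1 Lp_one_subproof.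

Definition cash_subadditive (rho : LfunType P p1 -> \bar R) : Prop :=
  (forall X Y : LfunType P p1, le_as X Y -> (rho Y <= rho X)%E) /\
  (forall (lambda : R) (X : LfunType P p1), 0 < lambda ->
     (rho X - lambda%:E <= rho (X + lambda *: Lp_one)%R)%E).

(* For 0 < beta < 1 the set below is nonempty and bounded below, so that inf
   is its genuine real infimum. *)
Definition VaR (beta : R) (X : T -> R) : R :=
  inf [set m : R | (P [set w | (X w + m < 0)%R] <= beta%:E)%E].

Definition TVaR (alpha : R) (X : T -> R) : \bar R :=
  (alpha^-1%:E *
   \int[lebesgue_measure]_(beta in `]0%R, alpha[) (VaR beta X)%:E)%E.

Definition TVaR_acceptance (alpha : R) : set (LfunType P p1) :=
  [set X : LfunType P p1 | (TVaR alpha X <= 0)%E].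

Record traded_asset : Type := TradedAsset {
  price : R;
  payoff : LfunType P p1;
  price_gt0 : 0 < price;
  payoff_ge0 : le_as (cst 0) payoff;
  payoff_neq0 : ~ {ae P, forall w, payoff w = 0}
}.

Definition risk_measure (A : set (LfunType P p1)) (S : traded_asset)
    (X : LfunType P p1) : \bar R :=
  ereal_inf [set m%:E | m in
    [set m : R | A (X + (m / price S) *: payoff S)]].

End Lp.

Arguments TVaR_acceptance {d T R} P {p} p1 alpha.
Arguments traded_asset {d T R} P {p} p1.

(* Main.v *)
From HB Require Import structures.
Require Import Defs.
From mathcomp Require Import all_boot all_order all_algebra.
From mathcomp Require Import all_classical all_reals all_analysis.
From mathcomp Require Import measurable_realfun ring lra.

Import Order.TTheory GRing.Theory Num.Theory.
Import numFieldNormedType.Exports.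

Local Open Scope classical_set_scope.
Local Open Scope ring_scope.

(* The acceptance set is a convex cone, so the "if" part reduces to the
   subadditivity of TVaR applied to the position (lambda / S_0) S_T - lambda.
   Subadditivity rests on the formula of Rockafellar and Uryasev
     TVaR_a(X) = min_c (c + E[max(- X - c, 0)] / a),
   which holds because b |-> VaR_b(X) has, under Lebesgue measure on ]0, 1[,
   the law of -X.  For the "only if" part it is enough to test cash
   subadditivity on X = -1 and lambda = 1: as rho(0) <= 0, one gets
   rho(-1) <= 1, i.e. TVaR_a((1 + e) S_T / S_0) <= -1 for all e > 0.
   Finally VaR_a <= TVaR_a gives the bound on P(S_T < S_0). *)

(** * Value-at-Risk as a quantile of the loss [- X] *)

Definition mfun_of {d} {T : measurableType d} {R : realType} {X : T -> R}
    (mX : measurable_fun setT X) : {mfun T >-> R} :=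
  HB.pack X (isMeasurableFun.Build _ _ _ _ X mX).

Section VaR.
Context {d} {T : measurableType d} {R : realType} {P : probability T R}.
Implicit Types (X Y : T -> R) (a b c k m : R).

Lemma measurable_shortfall X m : measurable_fun setT X ->
  measurable [set w | X w + m < 0].
Proof.
move=> mX; rewrite -[X in measurable X]setTI.
apply: (measurable_fun_ltr (f := fun w => X w + m) (g := cst 0)) => //.
exact: measurable_funD.
Qed.

Lemma shortfall_ccdf X m (mX : measurable_fun setT (\- X)) :
  P [set w | X w + m < 0] = ccdf (mfun_of mX : {RV P >-> R}) m.
Proof.
congr (P _); apply/funext => w /=.
by rewrite in_itv/= andbT ltrNr -ltrBrDr sub0r.
Qed.

(** The [ccdf] of [- X] is nonincreasing and right-continuous, so the infimum is attained and the
    defining set is a closed half-line. The other rules for [VaR] are read off from this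
    equivalence. *)
Lemma le_VaR b X m : 0 < b < 1 -> measurable_fun setT X ->
  (VaR P b X <= m) = (P [set w | (X w + m < 0)%R] <= b%:E)%E.
Proof.
move=> /andP[b0 b1] mX.
have mNX : measurable_fun setT (\- X) by exact: measurable_funN.
pose L : {RV P >-> R} := mfun_of mNX.
have -> : VaR P b X = inf [set n : R | (ccdf L n <= b%:E)%E].
  by congr inf; apply/funext => n /=; rewrite (shortfall_ccdf _ _ mNX).
rewrite (shortfall_ccdf _ _ mNX) -/L; set S := [set n | _].
have S0 : S !=set0.
  have : \forall n \near +oo, (ccdf L n < b%:E)%E.
    have := @cvg_ccdfy0 _ _ _ _ L.
    move=> /(_ [set x | (x < b%:E)%E]); apply.
    apply: open_nbhs_nbhs; split; first exact: open_ereal_lt_ereal.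
    by rewrite /= lte_fin.
  by move=> /filter_ex[n /ltW]; exists n.
have lbS : has_lbound S.
  have : \forall n \near -oo, (b%:E < ccdf L n)%E.
    have := @cvg_ccdfNy1 _ _ _ _ L.
    move=> /(_ [set x | (b%:E < x)%E]); apply.
    apply: open_nbhs_nbhs; split; first exact: open_ereal_gt_ereal.
    by rewrite /= lte_fin.
  move=> /filter_ex[n bn]; exists n => x Sx.
  rewrite leNgt; apply/negP => xn.
  have := lt_le_trans bn (ccdf_nonincreasing L (ltW xn)).
  by rewrite ltNge Sx.
apply/idP/idP => [|mS]; last exact: ge_inf.
move=> infm; apply: le_trans (ccdf_nonincreasing L infm) _.
have /= cvgL := @ccdf_right_continuous _ _ _ _ L (inf S).
rewrite leNgt; apply/negP => bL.
(* If the [ccdf] exceeded [b] at [inf S], it would do so just to the right as well, where [S] has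
   points. The right neighbourhood omits [inf S] itself, hence the case split on [s]. *)
have : \forall n \near (inf S)^'+, (b%:E < ccdf L n)%E.
  apply: (cvgL [set x | (b%:E < x)%E]).
  by apply: open_nbhs_nbhs; split; [exact: open_ereal_gt_ereal|].
move=> [e /= e0 He].
have [s Ss se] := inf_adherent e0 (conj S0 lbS).
have [si|si] := eqVneq s (inf S).
  by move: Ss; rewrite /S/= si leNgt bL.
have is_ : inf S < s by rewrite lt_neqAle eq_sym si ge_inf.
suff : (b%:E < ccdf L s)%E by rewrite ltNge Ss.
apply: He => //=; rewrite distrC ger0_norm ?subr_ge0; last exact: ltW.
by rewrite ltrBlDl.
Qed.

(** Equalities for [VaR] are proved by comparing upper bounds, since these are what [le_VaR]
    describes. *)
Let eq_le_all (x y : R) : (forall m, (x <= m) = (y <= m)) -> x = y.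
Proof. by move=> xy; apply/le_anti; rewrite xy lexx -xy lexx. Qed.

Lemma VaRD_cst b X c : 0 < b < 1 -> measurable_fun setT X ->
  VaR P b (fun w => X w + c) = VaR P b X - c.
Proof.
move=> b01 mX; apply: eq_le_all => m.
rewrite le_VaR//; last exact: measurable_funD.
rewrite lerBlDr le_VaR//; congr (P _ <= _)%E.
by apply/funext => w /=; rewrite -addrA (addrC c).
Qed.

Lemma VaRZ b X k : 0 < b < 1 -> 0 < k -> measurable_fun setT X ->
  VaR P b (fun w => k * X w) = k * VaR P b X.
Proof.
move=> b01 k0 mX; apply: eq_le_all => m.
rewrite le_VaR//; last exact: measurable_funM.
rewrite -ler_pdivlMl// le_VaR//; congr (P _ <= _)%E.
apply/funext => w /=.
by rewrite -[X in _ = is_true X](pmulr_rlt0 _ k0) mulrDr mulVKf// gt_eqF.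
Qed.

Lemma le_VaR_as b X Y : 0 < b < 1 ->
  measurable_fun setT X -> measurable_fun setT Y ->
  le_as P X Y -> VaR P b Y <= VaR P b X.
Proof.
move=> b01 mX mY [N [mN PN0 XYN]]; rewrite le_VaR//.
set m := VaR P b X.
have : (P [set w | (X w + m < 0)%R] <= b%:E)%E by rewrite -le_VaR.
(* The shortfall event of [Y] lies in that of [X] up to the null set [N]. *)
apply: le_trans; rewrite -[leRHS]adde0 -PN0.
apply: le_trans (measureU2 _ _ mN); last exact: measurable_shortfall.
apply: le_measure; rewrite ?inE.
- exact: measurable_shortfall.
- by apply: measurableU => //; exact: measurable_shortfall.
move=> w /= Ym; have [XY|XY] := leP (X w) (Y w); first by left; lra.
by right; apply: XYN => /=; apply/negP; rewrite -ltNge.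
Qed.

(** * [VaR] as a function of its level, and its law *)

Lemma VaR_nonincreasing X b c : 0 < b -> b <= c -> c < 1 ->
  measurable_fun setT X -> VaR P c X <= VaR P b X.
Proof.
move=> b0 bc c1 mX; rewrite le_VaR//; last by rewrite (lt_le_trans b0).
rewrite (@le_trans _ _ b%:E) ?lee_fin// -le_VaR//.
by rewrite b0 (le_lt_trans bc).
Qed.

Lemma measurable_VaR X : measurable_fun setT X ->
  measurable_fun (`]0, 1[ : set R) (fun b => VaR P b X).
Proof.
move=> mX mD; apply: (measurability (@RGenCInfty.G R)) => //.
  exact: RGenCInfty.measurableE.
(* By monotonicity in the level, the preimage of a closed ray is an interval. *)
move=> /= _ [_ [r ->] <-]; apply: is_interval_measurable => s t/=.
rewrite !in_itv/= !andbT => -[/andP[s0 s1] rs] [/andP[t0 t1] rt] u /andP[su ut].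
rewrite !in_itv/= andbT (lt_le_trans s0)//= (le_lt_trans ut)//; split => //.
by rewrite (le_trans rt)// VaR_nonincreasing// (lt_le_trans s0).
Qed.

(** Quantile transform: for a uniform level on []0, 1[], [VaR] has the law of [- X]. Both positive
    parts thus have the same [ccdf] on the positive half-line, and the layer-cake formula gives them
    the same expectation. *)
Lemma integral_VaR_pos X : measurable_fun setT X ->
  (\int[lebesgue_measure]_(b in `]0%R, 1%R[) (Num.max (VaR P b X) 0)%:E =
   \int[P]_w (Num.max (- X w) 0)%:E)%E.
Proof.
move=> mX.
pose phi : measurableTypeR R -> R :=
  (fun b => Num.max (VaR P b X) 0) \_ (`]0, 1[%classic).
have mmax : measurable_fun (`]0, 1[ : set R) (fun b => Num.max (VaR P b X) 0).
  by apply: measurable_maxr => //; exact: measurable_VaR.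
have mphi : measurable_fun setT phi by apply/(measurable_restrictT _ _).1.
have phi_ge0 b : 0 <= phi b.
  by rewrite /phi patchE; case: ifPn => // _; rewrite le_max lexx orbT.
pose U := uniform_prob (@ltr01 R).
have mY : measurable_fun setT (fun w => Num.max (- X w) 0).
  by apply: measurable_maxr => //; exact: measurable_funN.
transitivity ('E_U[mfun_of mphi])%E.
  rewrite expectation_def integral_uniform//=; last exact/measurable_EFinP.
  rewrite subr0 invr1 mul1e [RHS]integral_itv_bndoo//; last first.
    by apply/measurable_EFinP; apply: measurable_funTS; exact: mphi.
  by apply: eq_integral => b b01; rewrite /phi patchE b01.
transitivity ('E_P[mfun_of mY])%E; last by rewrite expectation_def.
rewrite !ge0_expectation_ccdf//; last first.
  by move=> w /=; rewrite le_max lexx orbT.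
apply: eq_integral => r; rewrite inE/= in_itv/= andbT => r0.
set p := P [set w | (X w + r < 0)%R].
have p_fin : p \is a fin_num.
  by apply: fin_num_measure; exact: measurable_shortfall.
have p1 : (p <= 1)%E by apply: probability_le1; exact: measurable_shortfall.
transitivity p; last first.
  congr (P _); apply/funext => w /=.
  by rewrite in_itv/= andbT lt_max [r < 0]ltNge r0 orbF ltrNr -ltrBrDr sub0r.
(* By [le_VaR], [r < VaR P b X] holds exactly when [b < p], so the event is []0, p[], of uniform
   probability [p]. *)
transitivity (U `]0, fine p[%classic).
  congr (uniform_prob _ _); apply/seteqP.
  split => b /=; rewrite !in_itv/= andbT.
    rewrite /phi patchE; case: ifPn; last by rewrite ltNge r0.
    rewrite inE/= in_itv/= => b01.
    rewrite lt_max => /orP[|]; last by rewrite ltNge r0.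
    rewrite ltNge le_VaR// -ltNge -/p -(fineK p_fin) lte_fin => ->.
    by case/andP : b01 => ->.
  move=> /andP[b0 bp]; have b1 : b < 1.
    by rewrite (lt_le_trans bp)// -lee_fin fineK.
  rewrite /phi patchE ifT; last by rewrite inE/= in_itv/= b0.
  rewrite lt_max; apply/orP; left.
  by rewrite ltNge le_VaR ?b0// -ltNge -/p -(fineK p_fin) lte_fin.
rewrite /U /uniform_prob.
rewrite (eq_integral (cst 1%E)).
  rewrite integral_cst//= mul1e lebesgue_measure_itv/= lte_fin.
  case: ifPn; first by rewrite sube0 fineK.
  rewrite -leNgt => p0; apply/eqP; rewrite eq_le measure_ge0/=.
  by rewrite -(fineK p_fin) lee_fin.
move=> b; rewrite inE/= in_itv/= => /andP[b0 bp].
rewrite /uniform_pdf subr0 invr1 ltW//= ltW//.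
by rewrite (lt_le_trans bp)// -lee_fin fineK.
Qed.

(** * Integrals of [VaR] and the Rockafellar-Uryasev formula *)

Notation integrable X := (P.-integrable setT (EFin \o X)).
Notation mu := (@lebesgue_measure R).

Let measurable_of X : integrable X -> measurable_fun setT X.
Proof. by move=> /measurable_int/measurable_EFinP. Qed.

Lemma integrableD_cst X c : integrable X -> integrable (fun w => X w + c).
Proof.
move=> iX; have ic := finite_measure_integrable_cst P c (@measurableT _ T).
exact: (integrableD measurableT iX ic).
Qed.

Lemma integrable_loss_pos X : integrable X ->
  integrable (fun w => Num.max (- X w) 0).
Proof.
move=> iX; apply: (@integrable_funrpos _ _ _ _ _ (fun w => - X w)) => //.
exact: (integrableN iX).
Qed.

Lemma integrable_VaR_pos X : integrable X ->
  mu.-integrable `]0, 1[ (EFin \o (fun b => Num.max (VaR P b X) 0)).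
Proof.
move=> iX; have mX := measurable_of _ iX.
apply/integrableP; split.
  by apply/measurable_EFinP/measurable_maxr => //; exact: measurable_VaR.
under eq_integral do rewrite gee0_abs ?lee_fin ?le_max ?lexx ?orbT//.
rewrite integral_VaR_pos//.
by apply: (@integrable_lty _ _ _ P); [|exact: integrable_loss_pos].
Qed.

Let subitv a : a < 1 -> `]0, a[ `<=` (`]0, 1[ : set R).
Proof. by move=> a1; apply: subset_itvl; rewrite bnd_simp ltW. Qed.

Let integrable_VaR_pos_itv a X : a < 1 -> integrable X ->
  mu.-integrable `]0, a[ (EFin \o (fun b => Num.max (VaR P b X) 0)).
Proof.
move=> a1 iX; apply: integrableS (integrable_VaR_pos _ iX) => //.
exact: subitv.
Qed.

Let integrable_cst_itv a c : mu.-integrable `]0, a[ (EFin \o cst c).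
Proof.
apply: measurable_bounded_integrable => //=.
  by rewrite lebesgue_measure_itv/=; case: ifPn => // _; rewrite sube0 ltry.
exact: bounded_cst.
Qed.

(** After adding [c = VaR P a X] to [X], the [VaR] is nonnegative at levels below [a]. It then
    equals its positive part, which is integrable, and the constant is added back. *)
Lemma integrable_VaR a X : 0 < a < 1 -> integrable X ->
  mu.-integrable `]0, a[ (EFin \o (fun b => VaR P b X)).
Proof.
move=> /andP[a0 a1] iX; have mX := measurable_of _ iX.
set c := VaR P a X.
have iY := integrable_VaR_pos_itv _ _ a1 (integrableD_cst _ c iX).
have mI : measurable (`]0, a[%classic : set (measurableTypeR R)).
  exact: measurable_itv.
apply: (eq_integrable mI _ _ _ (integrableD mI iY (integrable_cst_itv a c))).
move=> b; rewrite inE/= in_itv/= => /andP[b0 ba].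
have b1 := lt_trans ba a1.
rewrite -EFinD VaRD_cst ?b0//; congr EFin.
have /max_idPl -> : 0 <= VaR P b X - c; last by rewrite subrK.
by rewrite subr_ge0; apply: VaR_nonincreasing => //; exact: ltW.
Qed.

(** The inequality in the formula: bound [VaR] by its positive part, then enlarge []0, a[] to []0,
    1[]. Applied to [X + c], it covers every [c]. *)
Lemma Rintegral_VaR_le a X : 0 < a < 1 -> integrable X ->
  \int[mu]_(b in `]0, a[) VaR P b X <= \int[P]_w Num.max (- X w) 0.
Proof.
move=> a01 iX; have mX := measurable_of _ iX; have /andP[a0 a1] := a01.
have iV := integrable_VaR_pos _ iX.
have iV' := integrable_VaR_pos_itv _ _ a1 iX.
apply: fine_le.
- by apply: integrable_fin_num => //; exact: integrable_VaR.
- by apply: integrable_fin_num => //; exact: integrable_loss_pos.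
rewrite -integral_VaR_pos//.
apply: (@le_trans _ _ (\int[mu]_(b in `]0%R, a[) (Num.max (VaR P b X) 0)%:E)%E).
  apply: le_integral => //; first exact: integrable_VaR.
  by move=> b _; rewrite lee_fin le_max lexx.
apply: ge0_subset_integral => //.
- exact: measurable_int iV.
- by move=> b _; rewrite lee_fin le_max lexx orbT.
- exact: subitv.
Qed.

(** The case where the minimum is attained, normalised to [c = 0]: [VaR] is nonnegative before level
    [a] and nonpositive after it, so its positive part loses nothing on []0, a[] and vanishes
    beyond. *)
Lemma Rintegral_VaR_eq a X : 0 < a < 1 -> integrable X -> VaR P a X = 0 ->
  \int[mu]_(b in `]0, a[) VaR P b X = \int[P]_w Num.max (- X w) 0.
Proof.
move=> a01 iX Xa0; have mX := measurable_of _ iX; have /andP[a0 a1] := a01.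
congr fine; rewrite -integral_VaR_pos//.
rewrite -(setIidr (subitv _ a1)) integral_mkcondr.
apply: eq_integral => b; rewrite inE/= in_itv/= => /andP[b0 b1].
rewrite patchE; case: ifPn.
  rewrite inE/= in_itv/= => /andP[_ ba]; congr EFin; apply/esym/max_idPl.
  by rewrite -Xa0; apply: VaR_nonincreasing => //; exact: ltW.
rewrite notin_setE/= in_itv/= b0/= => /negP; rewrite -leNgt => ab.
congr EFin; apply/esym/max_idPr.
by rewrite -Xa0; apply: VaR_nonincreasing.
Qed.

Lemma Rintegral_VaRD_cst a X c : 0 < a < 1 -> integrable X ->
  \int[mu]_(b in `]0, a[) VaR P b (fun w => X w + c) =
  \int[mu]_(b in `]0, a[) VaR P b X - c * a.
Proof.
move=> a01 iX; have mX := measurable_of _ iX; have /andP[a0 a1] := a01.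
transitivity (\int[mu]_(b in `]0, a[) (VaR P b X + (- c))).
  apply: eq_Rintegral => b; rewrite inE/= in_itv/= => /andP[b0 ba].
  by rewrite VaRD_cst// b0 (lt_trans ba).
rewrite RintegralD//; [|exact: integrable_VaR|exact: integrable_cst_itv].
rewrite Rintegral_cst//= lebesgue_measure_itv/= lte_fin a0 sube0/=.
by rewrite mulNr.
Qed.

(** * Monotonicity, translation, homogeneity and subadditivity of [TVaR] *)

Lemma TVaRE a X : 0 < a < 1 -> integrable X ->
  TVaR P a X = (a^-1 * \int[mu]_(b in `]0, a[) VaR P b X)%:E.
Proof.
move=> a01 iX; rewrite /TVaR EFinM fineK//.
by apply: integrable_fin_num => //; exact: integrable_VaR.
Qed.

Lemma le_TVaR_as a X Y : 0 < a < 1 -> integrable X -> integrable Y ->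
  le_as P X Y -> (TVaR P a Y <= TVaR P a X)%E.
Proof.
move=> a01 iX iY XY; have /andP[a0 a1] := a01.
rewrite !TVaRE// lee_fin ler_pM2l ?invr_gt0//.
apply: le_Rintegral => //; [exact: integrable_VaR|exact: integrable_VaR|].
move=> b /=; rewrite in_itv/= => /andP[b0 ba].
by apply: le_VaR_as XY; [rewrite b0 (lt_trans ba)|exact: measurable_of..].
Qed.

Lemma TVaRD_cst a X c : 0 < a < 1 -> integrable X ->
  TVaR P a (fun w => X w + c) = (TVaR P a X - c%:E)%E.
Proof.
move=> a01 iX; have /andP[a0 a1] := a01.
rewrite !TVaRE//; last exact: integrableD_cst.
by rewrite Rintegral_VaRD_cst// mulrBr mulrCA mulVf ?mulr1// gt_eqF.
Qed.

Lemma TVaRZ a X k : 0 < a < 1 -> 0 < k -> integrable X ->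
  TVaR P a (fun w => k * X w) = (k%:E * TVaR P a X)%E.
Proof.
move=> a01 k0 iX; have /andP[a0 a1] := a01.
rewrite !TVaRE//; last exact: (integrableZl measurableT k iX).
rewrite -EFinM mulrCA -(@RintegralZl _ _ _ mu _ _ k)//; last first.
  exact: integrable_VaR.
congr (_ * _)%:E; apply: eq_Rintegral => b.
rewrite inE/= in_itv/= => /andP[b0 ba].
by rewrite VaRZ ?b0 ?(lt_trans ba)//; exact: measurable_of.
Qed.

(** Shift [X] and [Y] by their own [VaR] at level [a], where the formula is an equality. For the
    sum, the shift [x + y] need not be optimal, but the inequality suffices; the positive part is
    subadditive and the shifts cancel. *)
Lemma TVaRD a X Y : 0 < a < 1 -> integrable X -> integrable Y ->
  (TVaR P a (fun w => (X w + Y w)%R) <= TVaR P a X + TVaR P a Y)%E.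
Proof.
move=> a01 iX iY; have /andP[a0 a1] := a01.
have iXY : integrable (fun w => X w + Y w).
  exact: (integrableD measurableT iX iY).
have [mX mY] := (measurable_of _ iX, measurable_of _ iY).
rewrite !TVaRE// -EFinD lee_fin -mulrDr ler_pM2l ?invr_gt0//.
set x := VaR P a X; set y := VaR P a Y.
have iX' := integrableD_cst _ x iX; have iY' := integrableD_cst _ y iY.
have X0 : VaR P a (fun w => X w + x) = 0 by rewrite VaRD_cst// subrr.
have Y0 : VaR P a (fun w => Y w + y) = 0 by rewrite VaRD_cst// subrr.
have := Rintegral_VaRD_cst _ _ x a01 iX; rewrite Rintegral_VaR_eq// => EX.
have := Rintegral_VaRD_cst _ _ y a01 iY; rewrite Rintegral_VaR_eq// => EY.
have EXY := Rintegral_VaRD_cst _ _ (x + y) a01 iXY.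
have := Rintegral_VaR_le _ _ a01 (integrableD_cst _ (x + y) iXY).
rewrite EXY => leXY.
have : \int[P]_w Num.max (- (X w + Y w + (x + y))) 0 <=
    \int[P]_w Num.max (- (X w + x)) 0 + \int[P]_w Num.max (- (Y w + y)) 0.
  have pX := integrable_loss_pos _ iX'; have pY := integrable_loss_pos _ iY'.
  rewrite -RintegralD//; apply: le_Rintegral => //.
  - exact/integrable_loss_pos/integrableD_cst.
  - exact: (integrableD measurableT pX pY).
  move=> w _; rewrite ge_max; apply/andP; split.
    rewrite addrACA opprD lerD// le_max lexx//.
  by rewrite addr_ge0// le_max lexx orbT.
by move=> /(le_trans leXY); rewrite EX EY mulrDl addrACA -opprD lerD2r.
Qed.

(** An average over []0, a[] of a nonincreasing function is at least its value at [a]. *)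
Lemma VaR_le_TVaR a X : 0 < a < 1 -> integrable X ->
  ((VaR P a X)%:E <= TVaR P a X)%E.
Proof.
move=> a01 iX; have /andP[a0 a1] := a01.
rewrite TVaRE// lee_fin ler_pdivlMl//.
have -> : a * VaR P a X = \int[mu]_(b in `]0, a[) VaR P a X.
  by rewrite Rintegral_cst//= lebesgue_measure_itv/= lte_fin a0 sube0/= mulrC.
apply: le_Rintegral => //; [exact: integrable_cst_itv|exact: integrable_VaR|].
move=> b /=; rewrite in_itv/= => /andP[b0 ba].
by apply: VaR_nonincreasing => //; [exact: ltW|exact: measurable_of].
Qed.

End VaR.

(** A probability is finite, so [L^p] is contained in [L^1], where the results on [TVaR] apply. *)
Lemma Lp_integrable {d} {T : measurableType d} {R : realType}
    {P : probability T R} {p : \bar R} {p1 : (1 <= p)%E} (X : LfunType P p1) :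
  P.-integrable setT (EFin \o X).
Proof.
apply/Lfun1_integrable.
apply: (Lfun_subset (lexx _) p1 _ p1); last exact: LfunP.
exact: fin_num_measure.
Qed.

(** * Cash subadditivity of the risk measure *)

Section risk_measure_TVaR.
Context {d} {T : measurableType d} {R : realType} {P : probability T R}.
Context {p : \bar R} {p1 : (1 <= p)%E} {alpha : R} {S : traded_asset P p1}.
Hypothesis alpha01 : 0 < alpha < 1.
Local Notation rho := (risk_measure (TVaR_acceptance P p1 alpha) S).
Local Notation tvar := (TVaR P alpha).

Lemma risk_measure_TVaR_le_as (X Y : LfunType P p1) :
  le_as P X Y -> (rho Y <= rho X)%E.
Proof.
move=> XY; apply: ereal_inf_le_tmp => _ [m Am <-]; exists m; last by [].
have iX := Lp_integrable (X + (m / price S) *: payoff S).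
have iY := Lp_integrable (Y + (m / price S) *: payoff S).
apply: (le_trans (le_TVaR_as _ _ _ alpha01 iX iY _) Am).
by apply: filterS XY => w /= XYw; rewrite lerD2r.
Qed.

Lemma TVaR_payoff_cash_subadditive :
  (tvar (payoff S) <= (- price S)%:E)%E -> cash_subadditive rho.
Proof.
move=> tS; split=> [|l X l0]; first exact: risk_measure_TVaR_le_as.
have S0 := price_gt0 S.
apply/ereal_infP => _ [m Am <-]; rewrite leeBlDr; last by [].
(* If [m] makes [X + l] acceptable, then [m + l] makes [X] acceptable: the two positions differ by
   [k * payoff S - l], whose [TVaR] is at most [k * (- price S) + l = 0]. *)
rewrite -EFinD; apply: ereal_inf_lbound; exists (m + l); last by [].
pose Y : LfunType P p1 := X + l *: Lp_one P p1 + (m / price S) *: payoff S.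
have iY : P.-integrable setT (EFin \o Y) := Lp_integrable Y.
have iS := Lp_integrable (payoff S).
pose k := l / price S; have k0 : 0 < k by rewrite divr_gt0.
have ikS : P.-integrable setT (EFin \o (fun w => k * payoff S w)).
  exact: (integrableZl measurableT k iS).
rewrite /TVaR_acceptance/mkset; have -> : X + ((m + l) / price S) *: payoff S =
    (fun w => Y w + (k * payoff S w - l)) :> (T -> R).
  apply/funext => w.
  suff : X w + ((m + l) / price S) * payoff S w =
      X w + l * \1_[set: T] w + (m / price S) * payoff S w +
      (k * payoff S w - l) by [].
  by rewrite indicE in_setT mulr1 /k; field; rewrite gt_eqF.
apply: le_trans (TVaRD _ _ _ alpha01 iY (integrableD_cst _ _ ikS)) _.
rewrite TVaRD_cst// TVaRZ//.
rewrite -[leRHS]adde0; apply: leeD => //.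
rewrite EFinN oppeK.
have /lee_wpmul2l/(_ _ _ tS) : (0 <= k%:E)%E by rewrite lee_fin ltW.
move=> /(leeD2r l%:E)/le_trans; apply.
by rewrite -EFinM -EFinD lee_fin /k mulrN divfK ?gt_eqF// addNr.
Qed.

Lemma cash_subadditive_TVaR_payoff :
  cash_subadditive rho -> (tvar (payoff S) <= (- price S)%:E)%E.
Proof.
move=> [_ csub]; have S0 := price_gt0 S.
have iS := Lp_integrable (payoff S).
have i0 := Lp_integrable (0 : LfunType P p1).
have tvar0 : tvar (cst 0) = 0%E.
  (* Scaling zero by 2 gives [t = 2 * t] for its [TVaR], which is finite by [TVaRE]. *)
  have := TVaRZ _ (cst 0) 2 alpha01 (ltr0Sn R 1) i0.
  have -> : (fun w : T => 2 * cst 0 w) = cst 0 :> (T -> R).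
    by apply/funext => w /=; rewrite mulr0.
  rewrite TVaRE// -EFinM => -[] ?; congr EFin; lra.
have rho0 : (rho 0%R <= 0)%E.
  apply: ereal_inf_lbound; exists 0; last by [].
  by rewrite /TVaR_acceptance/mkset mul0r scale0r addr0 tvar0.
have rhoN1 : (rho (- Lp_one P p1)%R <= 1)%E.
  have := csub 1 (- Lp_one P p1) ltr01.
  rewrite scale1r addNr => /le_trans/(_ rho0).
  by rewrite leeBlDr// add0e.
(* The infimum [rho (- 1)] might not be attained; the slack [e] provides an acceptable
   [m < 1 + e]. *)
have tvar_le e : 0 < e -> ((1 + e)%:E * tvar (payoff S) <= (- price S)%:E)%E.
  move=> e0; have e1 : 0 < 1 + e by lra.
  have : (rho (- Lp_one P p1)%R < (1 + e)%:E)%E.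
    by rewrite (le_lt_trans rhoN1)// lte_fin ltrDl.
  move=> /ereal_inf_lt[_ [m Am <-]]; rewrite lte_fin => me.
  pose k := m / price S; pose K := (1 + e) / price S.
  have K0 : 0 < K by rewrite divr_gt0.
  have ikS c : P.-integrable setT (EFin \o (fun w => c * payoff S w)).
    exact: (integrableZl measurableT c iS).
  have : (tvar (fun w => k * payoff S w)%R <= (- 1)%:E)%E.
    move: Am; rewrite /TVaR_acceptance/mkset -/k.
    have -> : - Lp_one P p1 + k *: payoff S =
        (fun w => k * payoff S w + (- 1)) :> (T -> R).
      apply/funext => w.
      suff : - \1_[set: T] w + k * payoff S w = k * payoff S w - 1 by [].
      by rewrite indicE in_setT addrC.
    by rewrite TVaRD_cst// EFinN oppeK -leeBrDr// sub0e.
  (* The payoff is nonnegative almost surely, so raising [k] to [K] can only lower [TVaR]. The sign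
     of [k] is not known here, whereas [K > 0] lets [TVaRZ] apply. *)
  have : (tvar (fun w => K * payoff S w)%R <=
      tvar (fun w => k * payoff S w)%R)%E.
    apply: le_TVaR_as => //; apply: filterS (payoff_ge0 S) => w /= Sw.
    by rewrite ler_wpM2r// ler_pM2r ?invr_gt0// ltW.
  move=> /le_trans/[apply]; rewrite TVaRZ// TVaRE// -!EFinM !lee_fin /K.
  by rewrite mulrAC ler_pdivrMr// mulN1r.
move: tvar_le; rewrite TVaRE//; set t := (alpha^-1 * _) => tvar_le.
have t0 : t <= 0.
  by have := tvar_le 1 ltr01; rewrite -EFinM lee_fin; lra.
rewrite lee_fin; apply/ler_addgt0Pr => e e0.
(* As [t <= 0], the denominator is at least 1, and the error term [- t * (e / (1 - t))] is at most
   [e], even when [t = 0]. *)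
have := tvar_le (e / (1 - t)); rewrite divr_gt0 ?subr_gt0; last 2 first.
- by [].
- lra.
move=> /(_ isT); rewrite -EFinM lee_fin => H.
have : - t * (e / (1 - t)) <= e.
  by rewrite mulrA ler_pdivrMr; [nra|lra].
lra.
Qed.

End risk_measure_TVaR.

Theorem corollary5p3 (d : measure_display) (T : measurableType d)
    (R : realType) (P : probability T R) (Pna : nonatomic P)
    (p : \bar R) (p1 : (1 <= p)%E)
    (alpha : R) (alpha01 : 0 < alpha < 1) (S : traded_asset P p1) :
  (cash_subadditive (risk_measure (TVaR_acceptance P p1 alpha) S) <->
     (TVaR P alpha (payoff S) <= (- price S)%R%:E)%E) /\
  (cash_subadditive (risk_measure (TVaR_acceptance P p1 alpha) S) ->
     (P [set w | (payoff S w < price S)%R] <= alpha%:E)%E).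
Proof.
split; first split.
- exact: cash_subadditive_TVaR_payoff.
- exact: TVaR_payoff_cash_subadditive.
move=> /(cash_subadditive_TVaR_payoff alpha01) tS.
have iS := Lp_integrable (payoff S).
(* The resulting bound [VaR <= - price S] becomes the probability bound through [le_VaR] at
   [m = - price S]. *)
have := le_trans (VaR_le_TVaR _ _ alpha01 iS) tS.
rewrite lee_fin le_VaR//; congr (P _ <= _)%E.
by apply/funext => w /=; rewrite subr_lt0.
Qed.
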